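(* Let $a>0$ and let $\mathrm{Exp}_a:\mathbb{C}\to\mathbb{C}\times\mathbb{R}$ be given by $\mathrm{Exp}_a(u+iv)=(\exp_{\mathbb{C}}(u+iv),\,av)$ for $u,v\in\mathbb{R}$. Then: (a) $\mathrm{Exp}_a$ is a vector field defined on the (trivially) embedded submanifold $\mathbb{C}\equiv\mathbb{C}\times\{0\}\hookrightarrow\mathbb{C}\times\mathbb{R}\cong\mathbb{R}^3$ and valued in the (tangent bundle of the) ambient space $\mathbb{R}^3$. (b) $\mathrm{Exp}_a$ is a diffeomorphism onto its image, thus an embedding of the plane into $\mathbb{C}\times\mathbb{R}$ and, in particular, invertible (onto its image).
   Context: $\exp_{\mathbb{C}}(z)=e^z$ is the complex exponential. Diffeomorphism means $C^\infty$-diffeomorphism, and embedding means embedding in the sense of smooth manifolds. Submanifolds are considered as subsets of $\mathbb{R}^n$ for which the inclusion is an imbedding and the atlas is the one induced from $\mathbb{R}^n$. A vector field on a submanifold $M\subset\mathbb{R}^n$ valued in the tangent bundle of $\mathbb{R}^n$ is a smooth map $\xi:M\to\mathbb{R}^n$, identified with $p\mapsto(p,\xi(p))\in T\mathbb{R}^n\cong\mathbb{R}^n\times\mathbb{R}^n$; it need not be tangent to $M$. *)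

(* Defs.v *)
From HB Require Import structures.
From mathcomp Require Import all_boot all_order all_algebra.
From mathcomp Require Import complex.
From mathcomp Require Import all_classical all_reals all_analysis.

Set Implicit Arguments.
Unset Strict Implicit.
Unset Printing Implicit Defensive.

Import Order.TTheory GRing.Theory Num.Theory numFieldNormedType.Exports.
Local Open Scope classical_set_scope.
Local Open Scope ring_scope.
Local Open Scope complex_scope.

(* [C_on k U f]: f is of class C^k on U. Only meaningful when U is open: the
   differentials are those of the ambient space, and no restriction to U is
   taken. *)
Fixpoint C_on (R : realType) (m n k : nat) (U : set 'rV[R]_m)
    (f : 'rV[R]_m -> 'rV[R]_n) : Prop :=
  match k with
  | 0 => forall x, U x -> {for x, continuous f}
  | k'.+1 => (forall x, U x -> differentiable f x) /\
             (forall v : 'rV[R]_m, C_on k' U (fun x => 'd f x v))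
  end.

Definition smooth_on (R : realType) (m n : nat) (U : set 'rV[R]_m)
    (f : 'rV[R]_m -> 'rV[R]_n) : Prop :=
  forall k, C_on k U f.

(* A smooth chart of R^n: a C^oo-diffeomorphism between two open subsets. The
   two maps are total functions with irrelevant values outside these sets. *)
Record chart (R : realType) (n : nat) := Chart {
  chart_dom : set 'rV[R]_n;
  chart_cod : set 'rV[R]_n;
  chart_map : 'rV[R]_n -> 'rV[R]_n;
  chart_inv : 'rV[R]_n -> 'rV[R]_n;
  chart_dom_open : open chart_dom;
  chart_cod_open : open chart_cod;
  chart_map_smooth : smooth_on chart_dom chart_map;
  chart_inv_smooth : smooth_on chart_cod chart_inv;
  chart_map_cod : forall x, chart_dom x -> chart_cod (chart_map x);
  chart_inv_dom : forall y, chart_cod y -> chart_dom (chart_inv y);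
  chart_mapK : forall x, chart_dom x -> chart_inv (chart_map x) = x;
  chart_invK : forall y, chart_cod y -> chart_map (chart_inv y) = y }.

(* For d <= n: the inclusion R^d -> R^d x {0} of R^d in R^n, and the projection
   of R^n to its first d coordinates. *)
Definition to_slice (R : realType) (d n : nat) (x : 'rV[R]_d) : 'rV[R]_n :=
  x *m pid_mx d.

Definition of_slice (R : realType) (n d : nat) (y : 'rV[R]_n) : 'rV[R]_d :=
  y *m pid_mx d.

Definition slice (R : realType) (d n : nat) : set 'rV[R]_n :=
  range (@to_slice R d n).

(* [c] straightens [M]: its restriction to M, followed by [of_slice], is a chart
   of the atlas that M inherits from R^n. *)
Definition slice_chart (R : realType) (d n : nat) (M : set 'rV[R]_n)
    (c : chart R n) : Prop :=
  chart_map c @` (chart_dom c `&` M) = chart_cod c `&` @slice R d n.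

Definition submanifold (R : realType) (d n : nat) (M : set 'rV[R]_n) : Prop :=
  (d <= n)%N /\
  forall p, M p -> exists c : chart R n, chart_dom c p /\ slice_chart d M c.

(* Expression of f in the coordinates given by [c] (source) and [c'] (target). *)
Definition coord_expr (R : realType) (d m e n : nat) (c : chart R m)
    (c' : chart R n) (f : 'rV[R]_m -> 'rV[R]_n) (x : 'rV[R]_d) : 'rV[R]_e :=
  of_slice e (chart_map c' (f (chart_inv c (to_slice m x)))).

(* Smoothness of f : M -> N as a map between abstract manifolds, for a
   d-dimensional M in R^m and an e-dimensional N in R^n. The values of f outside
   M are irrelevant. *)
Definition smooth_map (R : realType) (d m : nat) (M : set 'rV[R]_m)
    (e n : nat) (N : set 'rV[R]_n) (f : 'rV[R]_m -> 'rV[R]_n) : Prop :=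
  (forall p, M p -> N (f p)) /\
  forall p, M p -> exists (c : chart R m) (c' : chart R n),
    [/\ chart_dom c p /\ slice_chart d M c,
        chart_dom c' (f p) /\ slice_chart e N c',
        forall q, chart_dom c q -> M q -> chart_dom c' (f q) &
        smooth_on [set x : 'rV[R]_d | chart_cod c (to_slice m x)]
          (coord_expr (d := d) e c c' f)].

(* A vector field along the submanifold M with values in the tangent bundle of
   R^n; xi p is the vector at p, not required to be tangent to M. *)
Definition ambient_vector_field (R : realType) (d n : nat) (M : set 'rV[R]_n)
    (xi : 'rV[R]_n -> 'rV[R]_n) : Prop :=
  submanifold d M /\ smooth_map d M n [set: 'rV[R]_n] xi.

Definition diffeomorphism (R : realType) (d m : nat) (M : set 'rV[R]_m)
    (n : nat) (N : set 'rV[R]_n) (f : 'rV[R]_m -> 'rV[R]_n) : Prop :=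
  [/\ submanifold d M, submanifold d N, smooth_map d M d N f &
      exists g : 'rV[R]_n -> 'rV[R]_m,
        [/\ smooth_map d N d M g,
            forall p, M p -> g (f p) = p &
            forall q, N q -> f (g q) = q]].

Definition immersion (R : realType) (m n : nat)
    (f : 'rV[R]_m -> 'rV[R]_n) : Prop :=
  smooth_on [set: 'rV[R]_m] f /\ forall x, injective ('d f x).

Definition topological_embedding (R : realType) (m n : nat)
    (f : 'rV[R]_m -> 'rV[R]_n) : Prop :=
  continuous f /\
  exists g : 'rV[R]_n -> 'rV[R]_m,
    {within range f, continuous g} /\ cancel f g.

Definition embedding (R : realType) (m n : nat)
    (f : 'rV[R]_m -> 'rV[R]_n) : Prop :=
  immersion f /\ topological_embedding f.

(* The identifications C = R^2 and C x R = R^3. *)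
Definition rV_of_C (R : realType) (z : R[i]) : 'rV[R]_2 :=
  \row_(j < 2) [:: complex.Re z; complex.Im z]`_j.

Definition C_of_rV (R : realType) (x : 'rV[R]_2) : R[i] :=
  x 0 0 +i* x 0 ord_max.

Definition rV_of_CR (R : realType) (w : R[i] * R) : 'rV[R]_3 :=
  \row_(j < 3) [:: complex.Re w.1; complex.Im w.1; w.2]`_j.

Definition CR_of_rV (R : realType) (x : 'rV[R]_3) : R[i] * R :=
  (x 0 0 +i* x 0 1, x 0 ord_max).

Lemma rV_of_CK (R : realType) : cancel (@rV_of_C R) (@C_of_rV R).
Proof. by case=> u v; rewrite /C_of_rV !mxE. Qed.

Lemma C_of_rVK (R : realType) : cancel (@C_of_rV R) (@rV_of_C R).
Proof.
move=> x; apply/rowP => -[[|[|//]] j]; rewrite !mxE /=;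
  by congr (x _ _); apply/val_inj.
Qed.

Lemma rV_of_CRK (R : realType) : cancel (@rV_of_CR R) (@CR_of_rV R).
Proof. by case=> -[u v] t; rewrite /CR_of_rV !mxE. Qed.

Lemma CR_of_rVK (R : realType) : cancel (@CR_of_rV R) (@rV_of_CR R).
Proof.
move=> x; apply/rowP => -[[|[|[|//]]] j]; rewrite !mxE /=;
  by congr (x _ _); apply/val_inj.
Qed.

(* The sum of the exponential series in C, for the topology of the modulus:
   R[i]^o is R[i] seen as a normed space over itself. *)
Definition expC (R : realType) (z : R[i]) : R[i] :=
  limn (series (fun n => z ^+ n / n`!%:R : R[i]^o)).

Definition Exp (R : realType) (a : R) (z : R[i]) : R[i] * R :=
  (expC z, a * complex.Im z).

Definition Exp_rV (R : realType) (a : R) (x : 'rV[R]_2) : 'rV[R]_3 :=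
  rV_of_CR (Exp a (C_of_rV x)).

Definition plane_incl (R : realType) (x : 'rV[R]_2) : 'rV[R]_3 :=
  rV_of_CR (C_of_rV x, 0).

(* [Exp a] as a field of vectors of R^3 along C x {0}. *)
Definition Exp_field (R : realType) (a : R) (p : 'rV[R]_3) : 'rV[R]_3 :=
  rV_of_CR (Exp a (CR_of_rV p).1).

(* Main.v *)
(* The map F(u, v, w) = ((e^u + i w) e^(iv), a v) is a diffeomorphism from R^3
   onto the open set of the (z, t) with Re (z e^(-it/a)) > 0, its inverse being
   (z, t) |-> (ln (Re (z e^(-it/a))), t/a, Im (z e^(-it/a))). Since Exp_a is F
   restricted to the plane w = 0, the inverse of F is a single slice chart for the
   whole image of Exp_a, in which Exp_a is the identity. The formula
   e^(u+iv) = e^u (cos v + i sin v) is obtained by differentiating the real power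
   series t |-> Re, Im (e^(t(u+iv))). *)

Require Import Defs.
From HB Require Import structures.
From mathcomp Require Import all_boot all_order all_algebra.
From mathcomp Require Import complex.
From mathcomp Require Import all_classical all_reals all_analysis.
From mathcomp Require Import ring lra.
Set Implicit Arguments.
Unset Strict Implicit.
Unset Printing Implicit Defensive.
Import Order.TTheory GRing.Theory Num.Theory numFieldNormedType.Exports.
Local Open Scope classical_set_scope.
Local Open Scope ring_scope.
Local Open Scope complex_scope.

(** * Maps of class C^k between normed spaces *)

(* [C_on] between arbitrary normed spaces, so that scalar functions, and hence
   products, are allowed. *)
Fixpoint Ck (R : realType) (V W : normedModType R) (k : nat) (U : set V)
    (f : V -> W) : Prop :=
  match k with
  | 0 => forall x, U x -> {for x, continuous f}
  | k'.+1 => (forall x, U x -> differentiable f x) /\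
             (forall v : V, @Ck R V W k' U (fun x => 'd f x v))
  end.
Arguments Ck {R V W} k U f.

Lemma C_on_of_Ck (R : realType) (m n k : nat) (U : set 'rV[R]_m)
    (f : 'rV[R]_m -> 'rV[R]_n) :
  Ck k U f -> C_on k U f.
Proof. by elim: k f => [//|k IH] f /= [df ddf]; split=> // v; apply: IH. Qed.

Lemma Ck_of_C_on (R : realType) (m n k : nat) (U : set 'rV[R]_m)
    (f : 'rV[R]_m -> 'rV[R]_n) :
  C_on k U f -> Ck k U f.
Proof. by elim: k f => [//|k IH] f /= [df ddf]; split=> // v; apply: IH. Qed.

(** The differential depends only on the germ: near [x] the first-order expansion of [f] is also one
    of [g], and uniqueness of the linear part identifies ['d g x]. *)
Lemma near_eq_is_diff (R : realType) (V W : normedModType R) (f g : V -> W)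
    (x : V) :
  (\forall y \near x, f y = g y) -> differentiable f x -> is_diff x g ('d f x).
Proof.
move=> fg dfx.
have fgx : f x = g x := nbhs_singleton fg.
have dgx : g \o shift x = cst (g x) + 'd f x +o_ 0 id.
  apply/eqaddoP => e e0.
  have /eqaddoP/(_ e e0) := diff_locally dfx.
  have fgs : \forall h \near 0, f (h + x) = g (h + x).
    by move: fg; rewrite (near_shift 0 x) /=; apply: filterS => y /=; rewrite subr0.
  apply: filterS2 fgs => h fgh.
  by rewrite !fctE /= fgx fgh.
have d := diff_unique (diff_continuous dfx) dgx.
by split=> //; apply/diff_locallyP; rewrite d; split=> //; exact: diff_continuous.
Qed.

Section Ck_theory.
Context {R : realType} {V : normedModType R}.

(** Rules of calculus give the differential only at points of [U]. Openness turns equality on [U]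
    into equality near each point, so the computed formula may replace the differential in every
    induction below. *)
Lemma Ck_eq {W : normedModType R} k (U : set V) (f g : V -> W) :
  open U -> (forall x, U x -> f x = g x) -> Ck k U f -> Ck k U g.
Proof.
move=> oU; elim: k f g => [|k IH] f g fg.
  move=> cf x Ux; rewrite /prop_for /continuous_at -fg //.
  apply: cvg_trans (cf x Ux); apply: near_eq_cvg.
  by near do apply: fg; exact: open_nbhs_nbhs.
have nfg x : U x -> \forall y \near x, f y = g y.
  by move=> Ux; near do apply: fg; exact: open_nbhs_nbhs.
move=> [df ddf]; split=> [x Ux|v].
  by have [] := near_eq_is_diff (nfg x Ux) (df x Ux).
apply: IH (ddf v) => x Ux.
by have [_ ->] := near_eq_is_diff (nfg x Ux) (df x Ux).
Unshelve. all: by end_near. Qed.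

Lemma CkW {W : normedModType R} k (U : set V) (f : V -> W) :
  Ck k.+1 U f -> Ck k U f.
Proof.
elim: k f => [|k IH] f [df ddf].
  by move=> x Ux; apply/differentiable_continuous/df.
by split=> // v; apply/IH/ddf.
Qed.

Lemma Ck_cst {W : normedModType R} k (U : set V) (c : W) : Ck k U (cst c).
Proof.
elim: k c => [|k IH] c; first by move=> x _; exact: cvg_cst.
split=> [x _|v]; first exact: differentiable_cst.
by rewrite (_ : (fun _ => _) = cst 0) //; apply/funext => x; rewrite diff_cst.
Qed.

Lemma Ck_comp_linear {W W' : normedModType R} k (U : set V) (f : V -> W)
    (L : {linear W -> W'}) :
  continuous L -> open U -> Ck k U f -> Ck k U (L \o f).
Proof.
move=> cL oU.
have dL x : differentiable L x := linear_differentiable x cL.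
elim: k f => [|k IH] f.
  by move=> cf x Ux; apply: continuous_comp; [exact: cf|move=> ?; exact: cL].
move=> [df ddf]; split=> [x Ux|v].
  by apply: differentiable_comp => //; exact: df.
apply: (@Ck_eq _ _ _ (L \o (fun x => 'd f x v)) _ oU _ (IH _ (ddf v))) => x Ux.
by rewrite [in RHS]diff_comp ?diff_lin //; exact: df.
Qed.

Lemma Ck_linear {W : normedModType R} k (U : set V) (L : {linear V -> W}) :
  continuous L -> Ck k U L.
Proof.
move=> cL; case: k => [x _|k]; first exact: cL.
split=> [x _|v]; first exact: linear_differentiable.
rewrite (_ : (fun _ => _) = cst (L v)); first exact: Ck_cst.
by apply/funext => x; rewrite diff_lin.
Qed.

Lemma CkD {W : normedModType R} k (U : set V) (f g : V -> W) :
  open U -> Ck k U f -> Ck k U g -> Ck k U (fun x => f x + g x).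
Proof.
move=> oU; elim: k f g => [|k IH] f g.
  by move=> cf cg x Ux; apply: continuousD; [exact: cf|exact: cg].
move=> [df ddf] [dg ddg]; split=> [x Ux|v].
  by apply: differentiableD; [exact: df|exact: dg].
apply: Ck_eq oU _ (IH _ _ (ddf v) (ddg v)) => x Ux.
by rewrite diffD //; [exact: df|exact: dg].
Qed.

Lemma CkM k (U : set V) (f g : V -> R) :
  open U -> Ck k U f -> Ck k U g -> Ck k U (fun x => f x * g x).
Proof.
move=> oU; elim: k f g => [|k IH] f g.
  by move=> cf cg x Ux; apply: continuousM; [exact: cf|exact: cg].
move=> Cf Cg; have [df ddf] := Cf; have [dg ddg] := Cg.
split=> [x Ux|v].
  by apply: differentiableM; [exact: df|exact: dg].
(* Each Leibniz term keeps one factor underived, so its order must be lowered from [k.+1] to [k]. *)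
apply: (Ck_eq oU) (CkD oU (IH _ _ (CkW Cf) (ddg v)) (IH _ _ (CkW Cg) (ddf v))).
by move=> x Ux; rewrite diffM //; [exact: df|exact: dg].
Qed.

Lemma CkN k (U : set V) (f : V -> R) :
  open U -> Ck k U f -> Ck k U (fun x => - f x).
Proof.
move=> oU Cf; have /(Ck_eq oU) := CkM oU (@Ck_cst R k U (-1)) Cf.
by apply=> x _; rewrite /cst mulN1r.
Qed.

(* Applied to a family of functions closed under derivation, this gives the
   smoothness of [h \o f] by induction on [k]. *)
Lemma Ck_compS k (U : set V) (f : V -> R) (h h' : R -> R) :
  open U -> Ck k.+1 U f ->
  (forall x, U x -> is_derive (f x) 1 h (h' (f x))) ->
  Ck k U (h' \o f) -> Ck k.+1 U (h \o f).
Proof.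
move=> oU Cf dh Ch'; have [df ddf] := Cf.
have ddh x : U x -> differentiable h (f x).
  by move=> Ux; apply/derivable1_diffP; have [] := dh x Ux.
split=> [x Ux|v].
  by apply: differentiable_comp; [exact: df|exact: ddh].
apply: Ck_eq oU _ (CkM oU Ch' (ddf v)) => x Ux.
rewrite [in RHS]diff_comp; [|exact: df|exact: ddh].
have [dhx vhx] := dh x Ux.
by rewrite /= deriv1E //= derive1E vhx mulrC.
Qed.

Lemma Ck0_comp (U : set V) (f : V -> R) (h : R -> R) :
  Ck 0 U f -> (forall x, U x -> {for f x, continuous h}) -> Ck 0 U (h \o f).
Proof. by move=> cf ch x Ux; apply: continuous_comp; [exact: cf|exact: ch]. Qed.

Lemma Ck_expR k (U : set V) (f : V -> R) :
  open U -> Ck k U f -> Ck k U (expR \o f).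
Proof.
move=> oU; elim: k => [|k IH] Cf.
  by apply: Ck0_comp => // x _; exact: continuous_expR.
by apply: Ck_compS (IH (CkW Cf)) => // x _; exact: is_derive_expR.
Qed.

(** Proved jointly, because up to sign each function is the derivative of the other. *)
Lemma Ck_cos_sin k (U : set V) (f : V -> R) :
  open U -> Ck k U f -> Ck k U (cos \o f) /\ Ck k U (sin \o f).
Proof.
move=> oU; elim: k => [|k IH] Cf.
  by split; apply: Ck0_comp => // x _; [exact: continuous_cos|exact: continuous_sin].
have [Cc Cs] := IH (CkW Cf).
by split; [apply: (@Ck_compS _ _ _ _ (fun y => - sin y)) => //; exact: CkN
          |apply: Ck_compS Cc => // x _; exact: is_derive_sin].
Qed.

(** The derivative of the inverse is a polynomial in the inverse itself, which closes the
    induction. *)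
Lemma Ck_inv k (U : set V) (f : V -> R) :
  open U -> (forall x, U x -> f x != 0) -> Ck k U f ->
  Ck k U (fun x => (f x)^-1).
Proof.
move=> oU f0; elim: k => [|k IH] Cf.
  by apply: (@Ck0_comp _ _ GRing.inv) => // x Ux; apply: inv_continuous; exact: f0.
apply: (@Ck_compS _ _ _ GRing.inv (fun y => - (y^-1 * y^-1))) => //.
  move=> x Ux; split; first exact: (derivableV (f0 x Ux) (@derivable_id R R _ _)).
  rewrite (deriveV (f0 x Ux) (@derivable_id R R _ _)) derive_id.
  by rewrite /GRing.scale /= mulr1 expr2 invfM.
by apply: (CkN oU); apply: CkM => //; apply: IH; exact: CkW.
Qed.

Lemma Ck_ln k (U : set V) (f : V -> R) :
  open U -> (forall x, U x -> 0 < f x) -> Ck k U f -> Ck k U (@ln R \o f).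
Proof.
move=> oU f0; case: k => [|k] Cf.
  by apply: Ck0_comp => // x Ux; apply: continuous_ln; exact: f0.
apply: (@Ck_compS _ _ _ (@ln R) GRing.inv) => //.
  by move=> x Ux; apply: is_derive1_ln; exact: f0.
by apply: Ck_inv => //; [move=> x Ux; rewrite gt_eqF ?f0|exact: CkW].
Qed.

End Ck_theory.

(** * Linear substitutions, coordinates and row vectors *)

Lemma Ck_precomp_linear (R : realType) (V V' W : normedModType R) k (U : set V) (f : V -> W)
    (L : {linear V' -> V}) :
  continuous L -> open U -> Ck k U f -> Ck k (L @^-1` U) (f \o L).
Proof.
move=> cL oU.
have dL x : differentiable L x := linear_differentiable x cL.
elim: k f => [|k IH] f.
  by move=> cf x Ux; apply: continuous_comp; [exact: cL|exact: cf].
move=> [df ddf]; split=> [x Ux|v].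
  by apply: differentiable_comp => //; exact: df.
apply: (@Ck_eq _ _ _ _ _ (fun x => 'd f (L x) (L v))).
- by apply: open_comp => // x _; exact: cL.
- by move=> x Ux; rewrite [in RHS]diff_comp ?diff_lin //; exact: df.
- exact: (IH (fun y => 'd f y (L v)) (ddf (L v))).
Qed.

Lemma Ck_coord (R : realType) n (j : 'I_n) k (U : set 'rV[R]_n) :
  Ck k U (fun x : 'rV[R]_n => x 0 j : R).
Proof.
have lin : linear (fun x : 'rV[R]_n => x 0 j : R).
  by move=> t x y; rewrite !mxE.
pose L := GRing.isLinear.Build _ _ _ _ _ lin.
pose c : {linear 'rV[R]_n -> R} := HB.pack (fun x : 'rV[R]_n => x 0 j : R) L.
exact: (@Ck_linear _ _ _ k U c (@coord_continuous _ _ _ _ _)).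
Qed.

(** Reduces vector-valued regularity to scalar regularity. The [w j] are the standard basis in
    [Ck_row], and the rows of a matrix in [mulmxr_continuous]. *)
Lemma Ck_sum_scale (R : realType) (V W : normedModType R) n k (U : set V)
    (c : 'I_n -> V -> R) (w : 'I_n -> W) :
  open U -> (forall j, Ck k U (c j)) ->
  Ck k U (fun x => \sum_j c j x *: w j).
Proof.
(* Induction on an arbitrary list of indices replacing the full enumeration. *)
move=> oU Cc; elim: (index_enum _) => [|j s IH].
  rewrite (_ : (fun _ => _) = cst 0); first exact: Ck_cst.
  by apply/funext => x; rewrite big_nil.
rewrite (_ : (fun _ => _) = fun x =>
  c j x *: w j + \sum_(i <- s) c i x *: w i); last first.
  by apply/funext => x; rewrite big_cons.
apply: CkD => //.
have lin : linear ( *:%R ^~ (w j) : R -> W).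
  by move=> u y z; rewrite scalerDl scalerA.
pose L := GRing.isLinear.Build _ _ _ _ _ lin.
pose l : {linear R -> W} := HB.pack ( *:%R ^~ (w j)) L.
exact: (@Ck_comp_linear _ _ _ _ k U (c j) l (@scalel_continuous _ _ _)).
Qed.

Lemma Ck_row (R : realType) (V : normedModType R) n k (U : set V)
    (f : V -> 'rV[R]_n) :
  open U -> (forall j, Ck k U (fun x => f x 0 j : R)) -> Ck k U f.
Proof.
move=> oU Cf.
have -> : f = (fun x => \sum_j f x 0 j *: delta_mx 0 j).
  by apply/funext => x; rewrite -row_sum_delta.
exact: (Ck_sum_scale _ oU Cf).
Qed.

Lemma mulmxr_continuous (R : realType) m n (A : 'M[R]_(m, n)) :
  continuous (mulmxr A : 'rV[R]_m -> 'rV[R]_n).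
Proof.
have : Ck 0 setT (mulmxr A : 'rV[R]_m -> 'rV[R]_n).
  rewrite (_ : (mulmxr A : 'rV[R]_m -> 'rV[R]_n) =
    fun x => \sum_j x 0 j *: row j A).
    by apply: Ck_sum_scale => [|j]; [exact: openT|exact: Ck_coord].
  by apply/funext => x; rewrite -mulmx_sum_row.
by move=> C x; exact: C.
Qed.

Lemma smooth_on_mulmxr (R : realType) m n (A : 'M[R]_(m, n)) U :
  smooth_on U (mulmxr A : 'rV[R]_m -> 'rV[R]_n).
Proof. by move=> k; apply/C_on_of_Ck/Ck_linear/mulmxr_continuous. Qed.

(** * Submanifolds straightened by a single chart *)

Lemma smooth_on_id (R : realType) n (U : set 'rV[R]_n) : smooth_on U id.
Proof.
have -> : id = mulmxr 1%:M :> ('rV[R]_n -> 'rV[R]_n).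
  by apply/funext => x; rewrite /= mulmx1.
exact: smooth_on_mulmxr.
Qed.

Definition id_chart (R : realType) n : chart R n :=
  @Chart R n setT setT id id openT openT (@smooth_on_id R n setT)
    (@smooth_on_id R n setT) (fun x => id) (fun x => id) (fun _ _ => erefl)
    (fun _ _ => erefl).

Section slice_theory.
Context {R : realType}.

Lemma to_sliceK d n : (d <= n)%N ->
  cancel (@to_slice R d n) (@of_slice R n d).
Proof.
move=> dn x; rewrite /to_slice /of_slice -mulmxA mul_pid_mx minnn.
by rewrite (minn_idPr dn) pid_mx_1 mulmx1.
Qed.

Lemma to_slice_id d (x : 'rV[R]_d) : to_slice d x = x.
Proof. by rewrite /to_slice pid_mx_1 mulmx1. Qed.

Lemma of_slice_id d (x : 'rV[R]_d) : of_slice d x = x.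
Proof. by rewrite /of_slice pid_mx_1 mulmx1. Qed.

Lemma slice_full d : @slice R d d = setT.
Proof. by apply/seteqP; split=> // x _; exists x; rewrite ?to_slice_id. Qed.

Lemma id_chart_full d : slice_chart d [set: 'rV[R]_d] (id_chart R d).
Proof. by rewrite /slice_chart slice_full /= image_id. Qed.

Lemma submanifold_full d : submanifold d [set: 'rV[R]_d].
Proof. by split=> // p _; exists (id_chart R d); split=> //; exact: id_chart_full. Qed.

(* [f] parametrizes, by the slice [R^d x {0}], the set straightened by the single
   chart [c]. *)
Section straightened.
Context {d n : nat} (dn : (d <= n)%N) (c : chart R n).
Context (f : 'rV[R]_d -> 'rV[R]_n) (cT : chart_cod c = setT).
Context (fE : forall x, f x = chart_inv c (to_slice n x)).

Let g (y : 'rV[R]_n) : 'rV[R]_d := of_slice d (chart_map c y).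

Lemma straightened_dom x : chart_dom c (f x).
Proof. by rewrite fE; apply: chart_inv_dom; rewrite cT. Qed.

Lemma straightened_map x : chart_map c (f x) = to_slice n x.
Proof. by rewrite fE chart_invK // cT. Qed.

Lemma straightenedK : cancel f g.
Proof. by move=> x; rewrite /g straightened_map to_sliceK. Qed.

Lemma straightened_slice_chart : slice_chart d (range f) c.
Proof.
rewrite /slice_chart cT setTI; apply/seteqP; split=> [_ [_ [_ [x _ <-]] <-]|_ [x _ <-]].
  by exists x; rewrite ?straightened_map.
exists (f x); last exact: straightened_map.
by split; [exact: straightened_dom|exists x].
Qed.

(** With the identity chart on R^d and [c] on the image, the coordinate expressions of both [f] and
    [g] are the identity. *)
Lemma straightened_diffeomorphism : diffeomorphism d setT (range f) f.
Proof.
have smoothE h : h = id -> smooth_on [set: 'rV[R]_d] h.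
  by move=> ->; exact: smooth_on_id.
split; first exact: submanifold_full.
- split=> // _ [x _ <-]; exists c.
  by split; [exact: straightened_dom|exact: straightened_slice_chart].
- split=> [x _|x _]; first by exists x.
  exists (id_chart R d), c; split=> //.
  + by split=> //; exact: id_chart_full.
  + by split; [exact: straightened_dom|exact: straightened_slice_chart].
  + by move=> y _ _; exact: straightened_dom.
  + apply: smoothE; apply/funext => x'.
    by rewrite /coord_expr /= straightened_map to_sliceK // to_slice_id.
exists g; split; [|by move=> x _; exact: straightenedK|
  by move=> _ [x _ <-]; rewrite straightenedK].
split=> // _ [x _ <-]; exists c, (id_chart R d); split=> //.
- by split; [exact: straightened_dom|exact: straightened_slice_chart].
- by split=> //; exact: id_chart_full.
- rewrite cT; apply: smoothE; apply/funext => x'.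
  by rewrite /coord_expr /= -fE straightenedK of_slice_id.
Qed.

Lemma straightened_smooth : smooth_on setT f.
Proof.
move=> k; apply: C_on_of_Ck.
have -> : f = chart_inv c \o mulmxr (pid_mx d) by apply/funext => x; rewrite fE.
have := @Ck_precomp_linear R 'rV[R]_n 'rV[R]_d 'rV[R]_n k setT (chart_inv c)
  (mulmxr (pid_mx d)) (@mulmxr_continuous _ _ _ _) openT.
by rewrite preimage_setT -cT; apply; exact/Ck_of_C_on/chart_inv_smooth.
Qed.

(** The image lies in the open domain of [c], so [g] is differentiable there in the ambient sense,
    not merely along the image. *)
Lemma straightened_inv_differentiable x : differentiable g (f x).
Proof.
apply: differentiable_comp.
  by have [+ _] := @chart_map_smooth _ _ c 1; apply; exact: straightened_dom.
exact: (@linear_differentiable _ _ _ (mulmxr (pid_mx d)) _ (@mulmxr_continuous _ _ _ _)).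
Qed.

(** The chain rule for [g \o f = id] makes ['d g (f x)] a left inverse of ['d f x], hence immersion;
    differentiability of [g] at the points of the image makes the inverse continuous there. *)
Lemma straightened_embedding : embedding f.
Proof.
have df x : differentiable f x by have [+ _] := straightened_smooth 1; apply.
have dg := straightened_inv_differentiable.
split; first split; first exact: straightened_smooth.
- move=> x; apply: (can_inj (g := 'd g (f x))) => v.
  transitivity ('d (g \o f) x v); first by rewrite [in RHS]diff_comp.
  have -> : g \o f = id by apply/funext => y; exact: straightenedK.
  by rewrite diff_val.
- split; first by move=> x; exact: differentiable_continuous.
  exists g; split; last exact: straightenedK.
  apply: continuous_in_subspaceT => _ /set_mem [x _ <-].
  exact: differentiable_continuous.
Qed.

End straightened.
End slice_theory.

(** * The complex exponential in real coordinates *)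

Section expC.
Context {R : realType}.
Implicit Types (w z : R[i]) (t : R).

Lemma ler_norm_Re z : `|complex.Re z| <= Normc.normc z.
Proof. by case: z => x y /=; rewrite -sqrtr_sqr ler_wsqrtr // lerDl sqr_ge0. Qed.

(** The factor [z] makes the family closed under derivation in [t], which replaces [z] by [z * w].
    It also covers imaginary parts, since Re (-i x) = Im x. *)
Definition Re_exp_coeff z w n : R := complex.Re (z * w ^+ n) / n`!%:R.

(* The real part of [z * exp (t * w)], as a real power series in [t]. *)
Definition Re_exp z w t : R := limn (pseries (Re_exp_coeff z w) t).

Lemma pseries_diffs_Re_exp_coeff z w :
  pseries_diffs (Re_exp_coeff z w) = Re_exp_coeff (z * w) w.
Proof.
apply/funext => n; rewrite /pseries_diffs /Re_exp_coeff exprS mulrA.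
by rewrite factS natrM invfM mulrCA mulVKf.
Qed.

(** Absolute convergence, by comparison with |z| times the real exponential series at |w| |t|. *)
Lemma is_cvg_Re_exp z w t : cvgn (pseries (Re_exp_coeff z w) t).
Proof.
apply: normed_cvg.
pose N : R := Normc.normc z; pose M : R := Normc.normc w * `|t|.
have normc_ge0 (x : R[i]) : 0 <= Normc.normc x :> R.
  by case: x => a b; exact: sqrtr_ge0.
have normcX (x : R[i]) n : Normc.normc (x ^+ n) = Normc.normc x ^+ n.
  elim: n => [|n IH]; first by rewrite !expr0 Normc.normc1.
  by rewrite !exprS Normc.normcM IH.
have M0 : 0 <= M by rewrite mulr_ge0.
apply: (@series_le_cvg _ _ (N *: exp_coeff M)) => [n|n|n|].
- exact: normr_ge0.
- by apply: mulr_ge0; [exact: normc_ge0|exact: exp_coeff_ge0].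
- rewrite /= /Re_exp_coeff !normrM normfV normrX (ger0_norm (ler0n _ _)).
  have -> : (N *: exp_coeff M) n = Normc.normc (z * w ^+ n) / n`!%:R * `|t| ^+ n.
    transitivity (N * (M ^+ n / n`!%:R)); first by [].
    by rewrite Normc.normcM normcX exprMn -/N; ring.
  by rewrite ler_wpM2r ?invr_ge0 // ler_wpM2r ?exprn_ge0 // ler_norm_Re.
- by apply: is_cvg_seriesZ; exact: is_cvg_series_exp_coeff.
Qed.

Lemma is_derive_Re_exp z w t : is_derive t 1 (Re_exp z w) (Re_exp (z * w) w t).
Proof.
rewrite /Re_exp -pseries_diffs_Re_exp_coeff.
(* Termwise derivation at [t] requires the series and its first two formal derivatives to converge
   at a point of modulus greater than |t|. *)
apply: (@pseries_snd_diffs _ _ (`|t| + 1)); rewrite ?pseries_diffs_Re_exp_coeff.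
- exact: is_cvg_Re_exp.
- exact: is_cvg_Re_exp.
- exact: is_cvg_Re_exp.
- by rewrite [ltRHS]ger0_norm// addrC -subr_gt0 addrK.
Qed.

(** Real linearity in [z] expresses the derivatives, taken at w and -i w, through the values at 1
    and -i. This yields the linear system of [spiral_ode]. *)
Lemma Re_exp_lin (a b : R) z z' w t :
  Re_exp (a%:C * z + b%:C * z') w t = a * Re_exp z w t + b * Re_exp z' w t.
Proof.
apply: cvg_lim; first exact: Rhausdorff.
rewrite (_ : pseries _ t = fun n => a * pseries (Re_exp_coeff z w) t n
   + b * pseries (Re_exp_coeff z' w) t n); last first.
  apply/funext => n; rewrite /pseries /series /= !mulr_sumr -big_split /=.
  apply: eq_bigr => k _; rewrite /Re_exp_coeff mulrDl -!mulrA.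
  case: (z * _) (z' * _) => [x y] [x' y'] /=; ring.
by apply: cvgD; apply: cvgMr; exact: is_cvg_Re_exp.
Qed.

Lemma Re_exp0 z w : Re_exp z w 0 = complex.Re z.
Proof.
apply: cvg_lim; first exact: Rhausdorff.
rewrite (_ : pseries _ 0 = fun n => complex.Re z * series (exp_coeff 0) n).
  rewrite -[X in _ --> X]mulr1 -(@expR0 R); apply: cvgMr.
  exact: is_cvg_series_exp_coeff.
apply/funext => n; rewrite /pseries /series /= mulr_sumr; apply: eq_bigr => k _.
(* Only the term of index 0 survives at [t = 0], where [0 ^+ 0 = 1]. *)
rewrite /exp_coeff /Re_exp_coeff /=; case: k => [|k].
  by rewrite !expr0 !mulr1 mul1r.
by rewrite !exprS !mul0r !mulr0.
Qed.

Lemma cvg_complex (x y : R^nat) (a b : R) :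
  x @ \oo --> a -> y @ \oo --> b ->
  (fun n => x n +i* y n : R[i]^o) @ \oo --> (a +i* b : R[i]^o).
Proof.
(* A positive element of [R[i]] has zero imaginary part, so the tolerance is a real [r]. Errors
   below r/2 in both components suffice, as 2 (r/2)^2 < r^2. *)
move=> xa yb; apply/cvgrPdist_lt => -[r s]; rewrite ltcE /= => /andP[/eqP-> r0].
have r2 : 0 < r / 2 by rewrite divr_gt0.
move/cvgrPdist_lt/(_ _ r2): xa; move/cvgrPdist_lt/(_ _ r2): yb.
apply: filterS2 => n; rewrite !ltr_norml => yn xn.
rewrite normc_def ltcR /= -(@ger0_norm _ r) ?ltW // -sqrtr_sqr ltr_sqrt ?exprn_gt0 //.
nra.
Qed.

(* The quantities conserved by the flow are the real and imaginary parts of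
   [(A + i B) / exp (t (u + i v))]. *)
Lemma spiral_ode (u v : R) (A B : R -> R) :
  (forall t, is_derive t 1 A (u * A t - v * B t)) ->
  (forall t, is_derive t 1 B (u * B t + v * A t)) ->
  A 0 = 1 -> B 0 = 0 ->
  A 1 = expR u * cos v /\ B 1 = expR u * sin v.
Proof.
move=> dA dB A0 B0.
pose E t := expR (- u * t); pose C t := cos (v * t); pose S t := sin (v * t).
have dl (c t : R) : is_derive t 1 ( *%R c) c.
  by apply: trigger_derive; rewrite /GRing.scale /= mulr1.
have dE t : is_derive t 1 E (- u * E t).
  by apply: is_derive_eq (is_derive1_comp (is_derive_expR _) (dl _ _)) _; rewrite mulrC.
have dC t : is_derive t 1 C (- v * S t).
  apply: is_derive_eq (is_derive1_comp (is_derive_cos _) (dl _ _)) _.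
  by rewrite mulNr mulrC mulNr.
have dS t : is_derive t 1 S (v * C t).
  by apply: is_derive_eq (is_derive1_comp (is_derive_sin _) (dl _ _)) _; rewrite mulrC.
have E0 : E 0 = 1 by rewrite /E mulr0 expR0.
have C0 : C 0 = 1 by rewrite /C mulr0 cos0.
have S0 : S 0 = 0 by rewrite /S mulr0 sin0.
have re : (E * (A * C + B * S)) 1 = (E * (A * C + B * S)) 0.
  apply: is_derive_0_is_cst => t.
  apply: is_derive_eq (is_deriveM (dE t)
    (is_deriveD (is_deriveM (dA t) (dC t)) (is_deriveM (dB t) (dS t)))) _.
  by rewrite /GRing.scale /= !fctE; ring.
have im : (E * (B * C - A * S)) 1 = (E * (B * C - A * S)) 0.
  apply: is_derive_0_is_cst => t.
  apply: is_derive_eq (is_deriveM (dE t)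
    (is_deriveB (is_deriveM (dB t) (dC t)) (is_deriveM (dA t) (dS t)))) _.
  by rewrite /GRing.scale /= !fctE; ring.
move: re im; rewrite !fctE E0 C0 S0 A0 B0 /E /C /S !mulr1 !mul1r mulr0 addr0 subr0.
rewrite expRN => re im.
have eu : expR u != 0 by rewrite expR_eq0.
have re' : A 1 * cos v + B 1 * sin v = expR u.
  by apply: (mulfI (invr_neq0 eu)); rewrite re mulVf.
have im' : B 1 * cos v - A 1 * sin v = 0.
  by apply: (mulfI (invr_neq0 eu)); rewrite im mulr0.
have cs := cos2Dsin2 v.
(* The two relations say that (A 1, B 1) rotated by -v is (e^u, 0). Rotating back by v solves for
   [A 1] and [B 1], with cos^2 + sin^2 = 1. *)
split.
  rewrite -re'.
  transitivity (A 1 * (cos v ^+ 2 + sin v ^+ 2) + (B 1 * cos v - A 1 * sin v) * sin v).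
    by rewrite im' cs; ring.
  ring.
rewrite -re'.
transitivity (B 1 * (cos v ^+ 2 + sin v ^+ 2) - (B 1 * cos v - A 1 * sin v) * cos v).
  by rewrite im' cs; ring.
ring.
Qed.

Lemma Re_exp1E (u v : R) :
  Re_exp 1 (u +i* v) 1 = expR u * cos v /\
  Re_exp (- 'i) (u +i* v) 1 = expR u * sin v.
Proof.
set w := u +i* v.
apply: (@spiral_ode u v (Re_exp 1 w) (Re_exp (- 'i) w)) => [t|t||]; last 2 first.
- exact: Re_exp0.
- by rewrite Re_exp0 /= oppr0.
(* Here w = u 1 + (-v) (-i); the next case uses -i w = u (-i) + v 1. *)
- rewrite -mulNr -Re_exp_lin.
  rewrite (_ : _ + _ = 1 * w); first exact: is_derive_Re_exp.
  by apply/eqP; rewrite eq_complex /w /=; apply/andP; split; apply/eqP; ring.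
- rewrite -Re_exp_lin.
  rewrite (_ : _ + _ = (- 'i) * w); first exact: is_derive_Re_exp.
  by apply/eqP; rewrite eq_complex /w /=; apply/andP; split; apply/eqP; ring.
Qed.

Lemma expCE (u v : R) :
  expC (u +i* v) = (expR u * cos v) +i* (expR u * sin v).
Proof.
apply: (@cvg_lim R[i]^o); first exact: norm_hausdorff.
rewrite (_ : series _ = fun n => pseries (Re_exp_coeff 1 (u +i* v)) 1 n +i*
   pseries (Re_exp_coeff (- 'i) (u +i* v)) 1 n); last first.
  apply/funext => n; rewrite /pseries /series /=.
  elim/big_rec3 : _ => // k x y z _ ->.
  (* The inverse factorial is rewritten as an embedded real number, so that multiplying by it acts
     componentwise. *)
  rewrite /Re_exp_coeff expr1n !mulr1 mul1r -(rmorph_nat (real_complex R)) -fmorphV.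
  case: (_ ^+ k) => p q; apply/eqP; rewrite eq_complex /=.
  by apply/andP; split; apply/eqP; ring.
have [<- <-] := Re_exp1E u v.
by apply: cvg_complex; exact: is_cvg_Re_exp.
Qed.
End expC.

(** * The straightening chart of the image of Exp *)

Lemma Ck_rV_of_CR (R : realType) (V : normedModType R) k (U : set V)
    (f g h : V -> R) :
  open U -> Ck k U f -> Ck k U g -> Ck k U h ->
  Ck k U (fun x => rV_of_CR (f x +i* g x, h x)).
Proof.
move=> oU Cf Cg Ch; apply: Ck_row => // -[[|[|[|//]]] i].
- by rewrite (_ : (fun _ => _) = f) //; apply/funext => x; rewrite mxE.
- by rewrite (_ : (fun _ => _) = g) //; apply/funext => x; rewrite mxE.
- by rewrite (_ : (fun _ => _) = h) //; apply/funext => x; rewrite mxE.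
Qed.

Lemma plane_inclE (R : realType) : @plane_incl R = @to_slice R 2 3.
Proof.
apply/funext => x; apply/rowP => -[[|[|[|//]]] i]; rewrite !mxE.
all: rewrite !big_ord_recl big_ord0 !mxE /=
   ?mulr1 ?mulr0 ?addr0 ?add0r //; congr (x _ _); exact/val_inj.
Qed.

Section helicoid.
Context {R : realType} (a : R) (a0 : 0 < a).

(* The real part of [z e^(-it/a)] at [p = (z, t)]. *)
Definition helicoid_radius (p : 'rV[R]_3) : R :=
  p 0 0 * cos (a^-1 * p 0 ord_max) + p 0 1 * sin (a^-1 * p 0 ord_max).

Definition helicoid_dom : set 'rV[R]_3 := [set p | 0 < helicoid_radius p].

Definition helicoid_map (p : 'rV[R]_3) : 'rV[R]_3 :=
  rV_of_CR (ln (helicoid_radius p) +i* (a^-1 * p 0 ord_max),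
    p 0 1 * cos (a^-1 * p 0 ord_max) - p 0 0 * sin (a^-1 * p 0 ord_max)).

(** This is F: a chart runs from the ambient space to the coordinates, so the parametrization is its
    inverse. At height a v, F sweeps the half-plane Re > 0 rotated by v. *)
Definition helicoid_inv (q : 'rV[R]_3) : 'rV[R]_3 :=
  rV_of_CR ((expR (q 0 0) * cos (q 0 1) - q 0 ord_max * sin (q 0 1))
    +i* (expR (q 0 0) * sin (q 0 1) + q 0 ord_max * cos (q 0 1)), a * q 0 1).

Lemma Ck_helicoid_angle k U :
  open U -> Ck k U (fun p : 'rV[R]_3 => a^-1 * p 0 ord_max : R).
Proof. by move=> oU; apply: CkM => //; [exact: Ck_cst|exact: Ck_coord]. Qed.

Lemma Ck_helicoid_radius k U : open U -> Ck k U helicoid_radius.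
Proof.
move=> oU; have [Cc Cs] := Ck_cos_sin oU (Ck_helicoid_angle k oU).
by apply: CkD => //; apply: CkM => //; exact: Ck_coord.
Qed.

Lemma open_helicoid_dom : open helicoid_dom.
Proof.
rewrite (_ : helicoid_dom = helicoid_radius @^-1` [set t | 0 < t]) //.
apply: open_comp; last exact: open_gt.
by move=> p _; have := Ck_helicoid_radius 0 openT; apply.
Qed.

Lemma smooth_helicoid_map : smooth_on helicoid_dom helicoid_map.
Proof.
move=> k; apply: C_on_of_Ck; have oU := open_helicoid_dom.
have [Cc Cs] := Ck_cos_sin oU (Ck_helicoid_angle k oU).
apply: Ck_rV_of_CR => //.
- by apply: Ck_ln => //; exact: Ck_helicoid_radius.
- exact: Ck_helicoid_angle.
- apply: CkD => //; last apply: CkN => //; apply: CkM => //; exact: Ck_coord.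
Qed.

Lemma smooth_helicoid_inv : smooth_on setT helicoid_inv.
Proof.
move=> k; apply: C_on_of_Ck; have oU := @openT 'rV[R]_3.
have Cx (j : 'I_3) : Ck k setT (fun q : 'rV[R]_3 => q 0 j : R) by exact: Ck_coord.
have [Cc Cs] := Ck_cos_sin oU (Cx 1).
have Ce := Ck_expR oU (Cx 0).
apply: Ck_rV_of_CR => //.
- by apply: CkD => //; last apply: CkN => //; apply: CkM.
- by apply: CkD => //; apply: CkM.
- by apply: CkM => //; exact: Ck_cst.
Qed.

Lemma helicoid_coordE (x y t : R) (p := rV_of_CR (x +i* y, t)) :
  [/\ p 0 0 = x, p 0 1 = y & p 0 ord_max = t].
Proof. by rewrite !mxE. Qed.

(** Multiplying (e^u + i w) e^(iv) by e^(-iv) leaves e^u + i w, whose real part is positive; hence F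
    takes its values in [helicoid_dom]. *)
Lemma helicoid_radius_inv q : helicoid_radius (helicoid_inv q) = expR (q 0 0).
Proof.
rewrite /helicoid_radius /helicoid_inv.
have [-> -> ->] := helicoid_coordE (expR (q 0 0) * cos (q 0 1) - q 0 ord_max * sin (q 0 1))
  (expR (q 0 0) * sin (q 0 1) + q 0 ord_max * cos (q 0 1)) (a * q 0 1).
rewrite mulKf ?gt_eqF // -[RHS]mulr1 -(cos2Dsin2 (q 0 1)); ring.
Qed.

Lemma helicoid_invK : cancel helicoid_inv helicoid_map.
Proof.
move=> q; rewrite /helicoid_map helicoid_radius_inv expRK /helicoid_inv.
have [-> -> ->] := helicoid_coordE (expR (q 0 0) * cos (q 0 1) - q 0 ord_max * sin (q 0 1))
  (expR (q 0 0) * sin (q 0 1) + q 0 ord_max * cos (q 0 1)) (a * q 0 1).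
rewrite mulKf ?gt_eqF // -[RHS]CR_of_rVK; congr (rV_of_CR (_, _)).
rewrite -[RHS]mulr1 -(cos2Dsin2 (q 0 1)); ring.
Qed.

(** Positivity of the radius is what lets [expR] undo [ln]; the rest is rotation by t/a after
    rotation by -t/a. *)
Lemma helicoid_mapK p : helicoid_dom p -> helicoid_inv (helicoid_map p) = p.
Proof.
move=> p0; rewrite /helicoid_inv /helicoid_map.
have [-> -> ->] := helicoid_coordE (ln (helicoid_radius p)) (a^-1 * p 0 ord_max)
  (p 0 1 * cos (a^-1 * p 0 ord_max) - p 0 0 * sin (a^-1 * p 0 ord_max)).
rewrite lnK // mulVKf ?gt_eqF // -[RHS]CR_of_rVK /helicoid_radius.
have cs := cos2Dsin2 (a^-1 * p 0 ord_max).
congr (rV_of_CR (_ +i* _, _)).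
  by rewrite -[RHS]mulr1 -cs; ring.
by rewrite -[RHS]mulr1 -cs; ring.
Qed.

Definition helicoid_chart : chart R 3 :=
  @Chart R 3 helicoid_dom setT helicoid_map helicoid_inv open_helicoid_dom openT
    smooth_helicoid_map smooth_helicoid_inv (fun _ _ => I)
    (fun q _ => eq_ind_r (fun r => is_true (0 < r)) (expR_gt0 (q 0 0)) (helicoid_radius_inv q))
    helicoid_mapK (fun q _ => helicoid_invK q).

Lemma Exp_rVE x : Exp_rV a x = chart_inv helicoid_chart (to_slice 3 x).
Proof.
rewrite -plane_inclE /= /helicoid_inv /plane_incl /C_of_rV.
have [-> -> ->] := helicoid_coordE (x 0 0) (x 0 ord_max) 0.
by rewrite !mul0r subr0 addr0 /Exp_rV /Exp expCE.
Qed.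

End helicoid.

Theorem proposition1p4 (R : realType) (a : R) (ha : 0 < a) :
  [/\ embedding (@plane_incl R),
      forall z : R[i], Exp_field a (rV_of_CR (z, 0)) = rV_of_CR (Exp a z) &
      ambient_vector_field 2 [set rV_of_CR (z, 0) | z in [set: R[i]]]
        (Exp_field a)] /\
  [/\ diffeomorphism 2 [set: 'rV[R]_2] (range (Exp_rV a)) (Exp_rV a),
      embedding (Exp_rV a) &
      set_bij [set: R[i]] (range (Exp a)) (Exp a)].
Proof.
have planeE : [set rV_of_CR (z, 0) | z in [set: R[i]]] = @slice R 2 3.
  rewrite /slice -plane_inclE; apply/seteqP; split=> _ [z _ <-].
    by exists (rV_of_C z); rewrite /plane_incl ?rV_of_CK.
  by exists (C_of_rV z).
have id_plane : slice_chart 2 (@slice R 2 3) (id_chart R 3).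
  by rewrite /slice_chart /= image_id.
have ExpE := Exp_rVE ha.
split; split.
(* The flat plane is the case where the straightening chart is the identity. *)
- apply: (@straightened_embedding R 2 3 isT (id_chart R 3)) => // x.
  by rewrite plane_inclE.
- by move=> z; rewrite /Exp_field rV_of_CRK.
- rewrite planeE; split; first by split=> // p _; exists (id_chart R 3).
  split=> // p pM; exists (id_chart R 3), (id_chart R 3); split=> //.
    by split=> //; exact: id_chart_full.
  (* In identity charts the field reads as [Exp_rV a], which is smooth as F restricted to the
     slice. *)
  rewrite (_ : coord_expr _ _ _ _ = Exp_rV a).
    exact: (@straightened_smooth R 2 3 (helicoid_chart ha)).
  apply/funext => x; rewrite /coord_expr /= of_slice_id -plane_inclE.
  by rewrite /plane_incl /Exp_field rV_of_CRK.
- exact: (@straightened_diffeomorphism R 2 3 isT (helicoid_chart ha)).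
- exact: (@straightened_embedding R 2 3 isT (helicoid_chart ha)).
- have ExpK := @straightenedK R 2 3 isT (helicoid_chart ha) _ erefl ExpE.
  split=> [z _|z z' _ _ zz'|_ [z _ <-]]; [by exists z| |by exists z].
  (* Injectivity on C comes from the left inverse of [Exp_rV a], transported through the real
     coordinates. *)
  apply: (can_inj (@rV_of_CK R)); apply: (can_inj ExpK).
  by rewrite /Exp_rV !rV_of_CK zz'.
Qed.
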